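(* Let $\mathbb{P}$ and $\mathbb{V}$ be two algebraic theories, $T_{\mathbb{P}}$ a stable universal set of $\mathbb{P}$-terms, and $T_{\mathbb{V}}$ a stable universal set of $\mathbb{V}$-terms. Let $m,n$ be natural numbers and suppose there are terms $\{1,\dots,m\} \vdash_{\mathbb{P}} p$ and $\{1,\dots,n\} \vdash_{\mathbb{V}} v$ and a fixed point free permutation $\sigma$ of $\{1,\dots,m\}$ such that: (P1) $p$ is stable under $\sigma$: $\{1,\dots,m\} \vdash_{\mathbb{P}} p = p[\sigma]$. (P2) $p$ is idempotent: $\{1\} \vdash_{\mathbb{P}} p[1/i] = 1$, where $p[1/i]$ is $p$ with the variable $1$ substituted for every variable $i$. (P3) For all $p' \in T_{\mathbb{P}}$ and all variable contexts $\Gamma$: if $\Gamma \vdash_{\mathbb{P}} p = p'$, then $\{1,\dots,m\} \vdash p'$. (V1) $v$ is idempotent: $\{1\} \vdash_{\mathbb{V}} v[1/i] = 1$, where $v[1/i]$ is $v$ with the variable $1$ substituted for every variable $i$. (V2) For all $v' \in T_{\mathbb{V}}$, all variables $x$ and all variable contexts $\Gamma$: if $\Gamma \vdash_{\mathbb{V}} x = v'$, then $\{x\} \vdash v'$. (V3) For all $v' \in T_{\mathbb{V}}$ and all variable contexts $\Gamma$: if $\Gamma \vdash_{\mathbb{V}} v = v'$, then there is no $i \in \Gamma$ with $\{i\} \vdash v'$. Then there is no composite theory of $\mathbb{P}$ and $\mathbb{V}$, in the sense in which every term separates as a $\mathbb{P}$-term built from $\mathbb{V}$-terms.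
   Context: An algebraic theory $\mathbb{T}$ consists of a signature $\Sigma^{\mathbb{T}}$ of finitary operation symbols (each with an arity in $\mathbb{N}$) and a set $E^{\mathbb{T}}$ of pairs of $\Sigma^{\mathbb{T}}$-terms (axioms). Variables are natural numbers. For a set $Y$ of variables, $Y \vdash t$ means that all variables of $t$ lie in $Y$ (written $Y\vdash_{\mathbb{T}} t$ when $t$ is a term of $\mathbb{T}$). $t_1 =_{\mathbb{T}} t_2$ means the two terms are provably equal from the axioms in (standard) equational logic, and $Y \vdash_{\mathbb{T}} t_1 = t_2$ means $Y \vdash t_1$, $Y\vdash t_2$ and $t_1 =_{\mathbb{T}} t_2$. $t[f]$ or $t[f(y)/y]$ denotes simultaneous substitution of $f(y)$ for $y$. A set of terms of a theory is universal if every term is provably equal to a term in the set, and stable if it is closed under substitution of variables for variables. Composite theory (separating as $\mathbb{P}$-terms of $\mathbb{V}$-terms): a composite of $\mathbb{P}$ and $\mathbb{V}$ is an algebraic theory $\mathbb{U}$ containing both $\mathbb{P}$ and $\mathbb{V}$ (their operations and axioms) such that: 1. Separation: every $\mathbb{U}$-term $u$ satisfies $u =_{\mathbb{U}} t[s_i/x_i]$ for some $\mathbb{P}$-term $t$ and $\mathbb{V}$-terms $s_i$. 2. Essential uniqueness: whenever $X \vdash_{\mathbb{P}} t$, $X' \vdash_{\mathbb{P}} t'$ and $Y_i\vdash_{\mathbb{V}} s_i$ (for $x_i\in X$), $Y'_{i'}\vdash_{\mathbb{V}} s'_{i'}$ (for $x'_{i'}\in X'$) are such that $t[s_i/x_i]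 =_{\mathbb{U}} t'[s'_{i'}/x'_{i'}]$, there are a set of variables $Z$ and functions $f: X \to Z$, $f': X' \to Z$ with: (a) $t[f(x_i)/x_i] =_{\mathbb{P}} t'[f'(x'_{i'})/x'_{i'}]$; (b) $f(x_i)=f(x_j) \Leftrightarrow s_i =_{\mathbb{V}} s_j$; (c) $f'(x'_{i'})=f'(x'_{j'}) \Leftrightarrow s'_{i'} =_{\mathbb{V}} s'_{j'}$; (d) $f(x_i)=f'(x'_{j'}) \Leftrightarrow s_i =_{\mathbb{V}} s'_{j'}$.
   Formalization: The formal theorem also assumes that the theory P is consistent (some two P-terms are not provably equal); for inconsistent P with a universal set of closed terms the claim as stated fails, since the inconsistent theory on both signatures is a composite. *)

(* Defs.v *)
From mathcomp Require Import all_boot.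
From mathcomp Require Import boolp classical_sets functions.

Set Implicit Arguments.
Unset Strict Implicit.
Unset Printing Implicit Defensive.

Local Open Scope classical_set_scope.

Record signature := Signature { symbol : Type; arity : symbol -> nat }.

Inductive term (S : signature) : Type :=
  | Var of nat
  | App (o : symbol S) of ('I_(arity o) -> term S).

Arguments Var {S} _.
Arguments App {S} o _.

Fixpoint subst (S : signature) (f : nat -> term S) (t : term S) : term S :=
  match t with
  | Var x => f x
  | App o a => App o (fun i => subst f (a i))
  end.

Definition rename (S : signature) (f : nat -> nat) (t : term S) : term S :=
  subst (fun x => Var (f x)) t.

Fixpoint vars (S : signature) (t : term S) : set nat :=
  match t with
  | Var x => [set x]
  | App o a => [set x | exists i, vars (a i) x]
  end.

(* Y |- t *)
Definition in_context (S : signature) (Y : set nat) (t : term S) : Prop :=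
  vars t `<=` Y.

Record theory := Theory {
  sig :> signature;
  axioms : set (term sig * term sig)
}.

Inductive provable_eq (T : theory) : term T -> term T -> Prop :=
  | peq_axiom l r : axioms (l, r) -> provable_eq l r
  | peq_refl t : provable_eq t t
  | peq_sym t u : provable_eq t u -> provable_eq u t
  | peq_trans t u w : provable_eq t u -> provable_eq u w -> provable_eq t w
  | peq_congr (o : symbol T) (a b : 'I_(arity o) -> term T) :
      (forall i, provable_eq (a i) (b i)) -> provable_eq (App o a) (App o b)
  | peq_subst (f : nat -> term T) t u :
      provable_eq t u -> provable_eq (subst f t) (subst f u).

Arguments provable_eq T _ _ : clear implicits.

(* Y |-_T t = u *)
Definition eq_in_context (T : theory) (Y : set nat) (t u : term T) : Prop :=
  [/\ in_context Y t, in_context Y u & provable_eq T t u].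

Arguments eq_in_context T Y t u : clear implicits.

(* The degenerate case to exclude: for the inconsistent theory with a single
   constant c and universal set {c}, conditions (P1)-(P3) hold for p := Var 1,
   m := 2, and the inconsistent theory does have composites with any V. *)
Definition consistent (T : theory) : Prop :=
  exists t u : term T, ~ provable_eq T t u.

Definition universal (T : theory) (A : set (term T)) : Prop :=
  forall t : term T, exists2 u, A u & provable_eq T t u.

Definition stable (T : theory) (A : set (term T)) : Prop :=
  forall (f : nat -> nat) (t : term T), A t -> A (rename f t).

Record sig_inclusion (S S' : signature) := SigInclusion {
  incl_symbol : symbol S -> symbol S';
  incl_arity : forall o, arity (incl_symbol o) = arity o;
  incl_inj : injective incl_symbol
}.

Fixpoint incl_term (S S' : signature) (h : sig_inclusion S S') (t : term S) :
    term S' :=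
  match t with
  | Var x => Var x
  | App o a => App (incl_symbol h o)
      (fun i => incl_term h (a (cast_ord (incl_arity h o) i)))
  end.

Definition theory_inclusion (T U : theory) (h : sig_inclusion T U) : Prop :=
  forall l r : term T, axioms (l, r) -> axioms (incl_term h l, incl_term h r).

Section Composite.
Variables (P V U : theory) (hP : sig_inclusion P U) (hV : sig_inclusion V U).

(* t[s_i/x_i], computed in U *)
Definition plug (t : term P) (s : nat -> term V) : term U :=
  subst (fun i => incl_term hV (s i)) (incl_term hP t).

Definition separation : Prop :=
  forall u : term U, exists (t : term P) (s : nat -> term V),
    provable_eq U u (plug t s).

(* The families s_i (x_i in X) and the functions f : X -> Z are represented by
   functions on nat; only their values on X matter. *)
Definition essential_uniqueness : Prop :=
  forall (X X' : set nat) (Y Y' : nat -> set nat)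
         (t t' : term P) (s s' : nat -> term V),
    in_context X t -> in_context X' t' ->
    (forall i, X i -> in_context (Y i) (s i)) ->
    (forall i, X' i -> in_context (Y' i) (s' i)) ->
    provable_eq U (plug t s) (plug t' s') ->
  exists (Z : set nat) (f f' : nat -> nat),
    [/\ forall i, X i -> Z (f i) & forall i, X' i -> Z (f' i)] /\
    [/\ provable_eq P (rename f t) (rename f' t'),
        forall i j, X i -> X j ->
          (f i = f j <-> provable_eq V (s i) (s j)),
        forall i j, X' i -> X' j ->
          (f' i = f' j <-> provable_eq V (s' i) (s' j)) &
        forall i j, X i -> X' j ->
          (f i = f' j <-> provable_eq V (s i) (s' j))].

End Composite.

(* P and V need not be disjoint inside U: only the individual inclusions of
   symbols are required to be injective. *)
Definition is_composite (P V U : theory) : Prop :=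
  exists (hP : sig_inclusion P U) (hV : sig_inclusion V U),
    [/\ theory_inclusion hP, theory_inclusion hV,
        separation hP hV & essential_uniqueness hP hV].

(* {1, ..., m} *)
Definition initial (m : nat) : set nat := [set i | 0 < i <= m].

Definition fixed_point_free_permutation (A : set nat) (sigma : nat -> nat) :
    Prop :=
  set_bij A A sigma /\ forall i, A i -> sigma i <> i.

(* Main.v *)
(** For variables x_{i,l}, the term v[p[x_{i,l}/i]/l] separates as t[s_k/x_k].
    Renaming x_{i,l} to l collapses it to v by idempotence of p, so essential
    uniqueness and (V3) give a variable x_k of t for which s_k contains some
    x_{i,a} and x_{i',b} with a <> b.  Renaming x_{i,l} to i collapses it to p
    by idempotence of v; so does renaming x_{i,a} to i and all other x_{i,l} to
    sigma i, since p is stable under sigma.  In both cases essential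
    uniqueness, (P3) and (V2) leave s_k with at most one variable: the first
    gives i = i', the second i = sigma i'. *)
Require Import Defs.
From mathcomp Require Import all_boot.
From mathcomp Require Import boolp classical_sets functions.

Set Implicit Arguments.
Unset Strict Implicit.
Unset Printing Implicit Defensive.

Local Open Scope classical_set_scope.

Lemma subst_eq_on (S : signature) (f g : nat -> term S) (t : term S) :
  (forall x, vars t x -> f x = g x) -> subst f t = subst g t.
Proof.
elim: t => [x|o a IH] /= fg; first exact: fg.
by congr App; apply: funext => i; apply: IH => x tx; apply: fg; exists i.
Qed.

Lemma subst_Var (S : signature) (t : term S) : subst Var t = t.
Proof. by elim: t => [//|o a IH] /=; congr App; apply: funext. Qed.

Lemma subst_comp (S : signature) (f g : nat -> term S) (t : term S) :
  subst g (subst f t) = subst (fun x => subst g (f x)) t.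
Proof. by elim: t => [//|o a IH] /=; congr App; apply: funext. Qed.

Lemma rename_comp (S : signature) (f g : nat -> nat) (t : term S) :
  rename g (rename f t) = rename (fun x => g (f x)) t.
Proof. exact: subst_comp. Qed.

Lemma vars_rename (S : signature) (f : nat -> nat) (t : term S) :
  vars (rename f t) = f @` vars t.
Proof.
rewrite /rename; elim: t => [x|o a IH] /=; first by rewrite image_set1.
apply/seteqP; split=> [y /= [i]|y [x [i aix] <-]] /=.
  by rewrite IH => -[x aix <-]; exists x => //; exists i.
by exists i; rewrite IH; exists x.
Qed.

Lemma provable_eq_subst (T : theory) (f g : nat -> term T) (t : term T) :
  (forall x, provable_eq T (f x) (g x)) ->
  provable_eq T (subst f t) (subst g t).
Proof. by move=> fg; elim: t => [x|o a IH] /=; [|exact: peq_congr]. Qed.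

(** If [y] did not occur in [t], substituting any [z] for [y] would leave [t] unchanged, so every
    [z] would be provably equal to [t]. *)
Lemma consistent_vars (T : theory) (y : nat) (t : term T) :
  consistent T -> provable_eq T (Var y) t -> vars t y.
Proof.
move=> [u [w uw]] yt; apply: contrapT => ty; apply: uw.
pose f z x : term T := if x == y then z else Var x.
have tE z : subst (f z) t = t.
  rewrite -[RHS]subst_Var; apply: subst_eq_on => x tx; rewrite /f.
  by case: eqP => // xy; move: ty; rewrite -xy.
have all_t z : provable_eq T z t.
  by have := peq_subst (f z) yt; rewrite tE /= /f eqxx.
exact: peq_trans (all_t u) (peq_sym (all_t w)).
Qed.

Lemma Var_inj (T : theory) (i j : nat) :
  consistent T -> provable_eq T (Var i) (Var j) -> i = j.
Proof. by move=> cT /(consistent_vars cT). Qed.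

Lemma incl_term_subst (S S' : signature) (h : sig_inclusion S S')
    (f : nat -> term S) (t : term S) :
  incl_term h (subst f t) = subst (fun x => incl_term h (f x)) (incl_term h t).
Proof. by elim: t => [//|o a IH] /=; congr App; apply: funext. Qed.

Lemma incl_term_provable_eq (T U : theory) (h : sig_inclusion T U)
    (t u : term T) :
  theory_inclusion h -> provable_eq T t u ->
  provable_eq U (incl_term h t) (incl_term h u).
Proof.
move=> hax; elim=> {t u}.
- by move=> l r /hax; exact: peq_axiom.
- by move=> t; exact: peq_refl.
- by move=> t u _; exact: peq_sym.
- by move=> t u w _ tu _; exact: peq_trans.
- by move=> o a b _ ab /=; apply: peq_congr.
- by move=> f t u _ tu; rewrite !incl_term_subst; exact: peq_subst.
Qed.

Section Plug.
Variables (P V U : theory) (hP : sig_inclusion P U) (hV : sig_inclusion V U).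

Lemma subst_plug (g : nat -> nat) (t : term P) (s : nat -> term V) :
  subst (fun x => Var (g x)) (plug hP hV t s)
  = plug hP hV t (fun k => rename g (s k)).
Proof.
rewrite /plug subst_comp; congr (subst _ _); apply: funext => k.
by rewrite incl_term_subst.
Qed.

Lemma plug_provable_eq (t t' : term P) (s s' : nat -> term V) :
  theory_inclusion hP -> theory_inclusion hV ->
  provable_eq P t t' -> (forall k, provable_eq V (s k) (s' k)) ->
  provable_eq U (plug hP hV t s) (plug hP hV t' s').
Proof.
move=> hPax hVax tt' ss'.
apply: (peq_trans (u := plug hP hV t' s)).
  by apply: peq_subst; exact: incl_term_provable_eq.
by apply: provable_eq_subst => k; exact: incl_term_provable_eq.
Qed.

(** Since (P3), (V2) and (V3) speak only of terms in [TP] and [TV], separated forms have to be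
    chosen there. *)
Lemma separation_universal (TP : set (term P)) (TV : set (term V)) :
  theory_inclusion hP -> theory_inclusion hV -> separation hP hV ->
  universal TP -> universal TV ->
  forall u : term U, exists (t : term P) (s : nat -> term V),
    [/\ TP t, forall k, TV (s k) & provable_eq U u (plug hP hV t s)].
Proof.
move=> hPax hVax sepU TPu TVu u; have [t [s uts]] := sepU u.
have [t' TPt' tt'] := TPu t.
have /choice[s' s'P] k : exists w, TV w /\ provable_eq V (s k) w.
  by have [w] := TVu (s k); exists w.
exists t', s'; split=> // [k|]; first by have [] := s'P k.
apply: peq_trans uts _; apply: plug_provable_eq => // k.
by have [] := s'P k.
Qed.

Hypothesis uniqU : essential_uniqueness hP hV.

(** Viewing [v] as the variable 0 with [v] plugged in, essential uniqueness equates a renaming of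
    [t] with a variable. By consistency of [P] that variable is [f k] for some [k] in [t]. *)
Lemma plug_eq_incl_V (t : term P) (s : nat -> term V) (v : term V) :
  consistent P -> provable_eq U (plug hP hV t s) (incl_term hV v) ->
  exists2 k, vars t k & provable_eq V (s k) v.
Proof.
move=> cP tsv.
have [//|//|//|//|Z [f [f' [_ [tf _ _ ff']]]]] :=
  uniqU (X := vars t) (X' := [set 0]) (Y := fun=> setT) (Y' := fun=> setT)
    (t' := Var 0) (s' := fun=> v) _ _ _ _ tsv.
have := consistent_vars cP (peq_sym tf).
rewrite vars_rename => -[k tk fk]; exists k => //.
by apply/(ff' k 0 tk).
Qed.

(** Viewing [p] as itself with variables plugged in gives [t[f] = p[f']], where [f'] is injective on
    [X] because [V] is consistent. The spare variable [x0] marks the values missed by [f']. *)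
Lemma plug_eq_incl_P (TP : set (term P)) (X : set nat) (x0 : nat)
    (t p : term P) (s : nat -> term V) :
  consistent V -> stable TP -> TP t -> ~ X x0 -> in_context X p ->
  (forall p', TP p' -> provable_eq P p p' -> in_context X p') ->
  provable_eq U (plug hP hV t s) (incl_term hP p) ->
  forall k, vars t k -> exists2 j, X j & provable_eq V (Var j) (s k).
Proof.
move=> cV TPs TPt Xx0 pX pmin tsp k tk.
have tsp' : provable_eq U (plug hP hV t s) (plug hP hV p Var).
  by rewrite {2}/plug subst_Var.
have [//|//|//|//|Z [f [f' [_ [tf _ f'inj ff']]]]] :=
  uniqU (X := vars t) (X' := X) (Y := fun=> setT) (Y' := fun=> setT)
   _ _ _ _ tsp'.
(* A left inverse g of f' sending everything off f'(X) outside X: then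
   p = t[g o f], so by minimality f k cannot lie off f'(X). *)
have /choice[g gP] z : exists j,
    X j /\ f' j = z \/ j = x0 /\ ~ exists2 j, X j & f' j = z.
  have [[j Xj f'j]|noj] := pselect (exists2 j, X j & f' j = z).
    by exists j; left.
  by exists x0; right.
have gf' j : X j -> g (f' j) = j.
  move=> Xj; have [[Xg f'g]|[_ []]] := gP (f' j); last by exists j.
  by apply: (Var_inj cV); apply/(f'inj _ _ Xg Xj).
have pg : provable_eq P p (rename (fun x => g (f x)) t).
  rewrite -rename_comp; apply: peq_sym.
  rewrite -[X in provable_eq P _ X](_ : rename g (rename f' p) = p).
    exact: peq_subst.
  rewrite rename_comp -[RHS]subst_Var; apply: subst_eq_on => x px.
  by rewrite gf' //; exact: pX.
have /(_ (g (f k))) Xgfk := pmin _ (TPs _ _ TPt) pg.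
have [[Xg f'g]|[gx0 _]] := gP (f k).
  by exists (g (f k)) => //; apply: peq_sym; apply/(ff' _ _ tk Xg).
by case: Xx0; rewrite -gx0; apply: Xgfk; rewrite vars_rename; exists k.
Qed.

Variables (p : term P) (v : term V).
Hypotheses (hPax : theory_inclusion hP) (hVax : theory_inclusion hV).

(** The variable x_{i,l} is coded as [pickle (i, l)]; fixing l selects a column, a copy of [p]. *)
Definition matrix_term : term U :=
  subst (fun l => subst (fun i => Var (pickle (i, l))) (incl_term hP p))
    (incl_term hV v).

Definition uncurry_var (G : nat -> nat -> nat) (x : nat) : nat :=
  if unpickle x is Some (i, l) then G i l else 0.

Lemma rename_matrix_term (G : nat -> nat -> nat) :
  rename (uncurry_var G) matrix_term
  = subst (fun l => incl_term hP (rename (G^~ l) p)) (incl_term hV v).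
Proof.
rewrite /rename /matrix_term subst_comp; congr (subst _ _).
apply: funext => l; rewrite subst_comp incl_term_subst; congr (subst _ _).
by apply: funext => i /=; rewrite /uncurry_var pickleK.
Qed.

Lemma matrix_term_idem_P :
  provable_eq P (rename (fun=> 1) p) (Var 1) ->
  provable_eq U (rename (uncurry_var (fun _ l => l)) matrix_term)
    (incl_term hV v).
Proof.
move=> pidem; rewrite rename_matrix_term -[X in provable_eq U _ X]subst_Var.
apply: provable_eq_subst => l.
apply: (incl_term_provable_eq (u := Var l) hPax).
by have := peq_subst (fun=> Var l) pidem; rewrite /rename subst_comp.
Qed.

(** Each column becomes provably equal to [p], so what remains is [v] applied to equal arguments. *)
Lemma matrix_term_idem_V (G : nat -> nat -> nat) :
  provable_eq V (rename (fun=> 1) v) (Var 1) ->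
  (forall l, provable_eq P (rename (G^~ l) p) p) ->
  provable_eq U (rename (uncurry_var G) matrix_term) (incl_term hP p).
Proof.
move=> videm pG; rewrite rename_matrix_term.
apply: (peq_trans (u := subst (fun=> incl_term hP p) (incl_term hV v))).
  by apply: provable_eq_subst => l; exact: incl_term_provable_eq.
have := peq_subst (fun=> incl_term hP p) (incl_term_provable_eq hVax videm).
by rewrite incl_term_subst subst_comp.
Qed.

End Plug.

Theorem theorem3p12 (P V : theory) (TP : set (term P)) (TV : set (term V))
    (TP_stable : stable TP) (TP_universal : universal TP)
    (TV_stable : stable TV) (TV_universal : universal TV)
    (P_consistent : consistent P)
    (m n : nat) (p : term P) (v : term V) (sigma : nat -> nat)
    (p_ctx : in_context (initial m) p)
    (v_ctx : in_context (initial n) v)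
    (sigma_perm : fixed_point_free_permutation (initial m) sigma)
    (P1 : eq_in_context P (initial m) p (rename sigma p))
    (P2 : eq_in_context P [set 1] (rename (fun=> 1) p) (Var 1))
    (P3 : forall (p' : term P) (Gamma : set nat), TP p' ->
      eq_in_context P Gamma p p' -> in_context (initial m) p')
    (V1 : eq_in_context V [set 1] (rename (fun=> 1) v) (Var 1))
    (V2 : forall (v' : term V) (x : nat) (Gamma : set nat), TV v' ->
      eq_in_context V Gamma (Var x) v' -> in_context [set x] v')
    (V3 : forall (v' : term V) (Gamma : set nat), TV v' ->
      eq_in_context V Gamma v v' ->
      ~ exists2 i, Gamma i & in_context [set i] v') :
  ~ exists U : theory, is_composite P V U.
Proof.
move=> [U [hP [hV [hPax hVax sepU uniqU]]]].
have [_ _ p_sigma] := P1; have [_ _ p_idem] := P2; have [_ _ v_idem] := V1.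
(* If [V] were inconsistent, [v] would equal a member of [TV] with all variables renamed to 1,
   against (V3). *)
have V_consistent : consistent V.
  apply: contrapT => /forallNP V_incons.
  have V_eq t u : provable_eq V t u.
    by apply: contrapT => tu; apply: (V_incons t); exists u.
  have [w TVw _] := TV_universal v.
  apply: (V3 (rename (fun=> 1) w) setT).
  - exact: TV_stable.
  - by split=> //; exact: V_eq.
  - by exists 1 => // x; rewrite vars_rename => -[y _ <-].
pose M := matrix_term hP hV p v.
have [t [s [TPt TVs Mts]]] :=
  separation_universal hPax hVax sepU TP_universal TV_universal M.
(* Renaming acts on the separated form only inside the [s k], so the same [t] and [k] serve every
   choice of [G]. *)
have collapse (G : nat -> nat -> nat) (u : term U) :
    provable_eq U (rename (uncurry_var G) M) u ->
    provable_eq U (plug hP hV t (fun k => rename (uncurry_var G) (s k))) u.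
  move=> Gu; rewrite -subst_plug; apply: peq_trans Gu; apply: peq_sym.
  exact: peq_subst.
have [k tk skv] := plug_eq_incl_V uniqU P_consistent
  (collapse _ _ (matrix_term_idem_P hV v hPax p_idem)).
have single (G : nat -> nat -> nat) :
    (forall l, provable_eq P (rename (G^~ l) p) p) ->
    exists2 j, initial m j &
      forall x, vars (s k) x -> uncurry_var G x = j.
  move=> pG.
  have pmin p' : TP p' -> provable_eq P p p' -> in_context (initial m) p'.
    by move=> TPp' pp'; apply: (P3 _ setT).
  have m0 : ~ initial m 0 by [].
  have [j mj jsk] :=
    plug_eq_incl_P uniqU V_consistent TP_stable TPt m0 p_ctx pmin
      (collapse _ _ (matrix_term_idem_V hPax hVax v_idem pG)) tk.
  have skj : in_context [set j] (rename (uncurry_var G) (s k)).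
    by apply: (V2 _ _ setT) => //; exact: TV_stable.
  by exists j => // x skx; apply: skj; rewrite vars_rename; exists x.
have id_p : provable_eq P (rename id p) p.
  by rewrite /rename subst_Var; exact: peq_refl.
have [i mi si] := single (fun i _ => i) (fun=> id_p).
(* Otherwise the renamed [s k], which equals [v] and lies in [TV] by stability, would have at most
   one variable, against (V3). *)
have [a [b [ska skb ab]]] : exists a b, [/\
    vars (rename (uncurry_var (fun _ l => l)) (s k)) a,
    vars (rename (uncurry_var (fun _ l => l)) (s k)) b & a <> b].
  apply: contrapT => nab.
  apply: (V3 _ setT (TV_stable (uncurry_var (fun _ l => l)) _ (TVs k))).
    by split=> //; exact: peq_sym.
  have [[a ska]|novar] := pselect
      (exists a, vars (rename (uncurry_var (fun _ l => l)) (s k)) a).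
    exists a => // b skb; apply: contrapT => ba.
    by apply: nab; exists b, a.
  by exists 0 => // b skb; case: novar; exists b.
(* The junk value 0 of uncurry_var differs from i >= 1. *)
have code x c : vars (s k) x -> uncurry_var (fun _ l => l) x = c ->
    unpickle x = Some (i, c).
  move=> /si; rewrite /uncurry_var; case: (unpickle x) => [[i' l] -> -> //|i0].
  by move: mi; rewrite -i0.
have [l|j _ sj] := single (fun i l => if l == a then i else sigma i).
  by case: (l == a); [exact: id_p|exact: peq_sym].
move: ska skb; rewrite !vars_rename => -[x skx xa] [y sky yb].
(* Here [x] codes x_{i,a}, giving [i = j], and [y] codes x_{i,b} with b different from a, giving
   [sigma i = j]: a fixed point of [sigma]. *)
have := sj x skx; rewrite /uncurry_var (code x a skx xa) eqxx => ij.
have := sj y sky; rewrite /uncurry_var (code y b sky yb).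
rewrite ifN; last by apply/eqP => ba; apply: ab.
by rewrite -ij; case: sigma_perm => _; apply.
Qed.
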